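(* Let $\overline{E}$ and $\overline{F}$ be two 0-1 sequences of the same length. Suppose that there are positive integers $t$ and $r_i,k_i$ ($1\le i\le t$) with $r_{i+1}-(r_i+k_i)\ge 0$ for $1\le i<t$ such that, after adding the digit $1$ as the first digit, the binary values of the resulting sequences are $$\overline{1E}=\frac{\sum_{i=1}^{t}2^{r_i-1}\left(2^{k_i+1}-2\right)}{2},\qquad \overline{1F}=\left\lfloor\frac{\sum_{i=1}^{t}2^{r_i-1}\left(2^{k_i}+1\right)}{2}\right\rfloor .$$ Then the vertex of the Stern-Brocot tree with 0-1 sequence $\overline{E}$ is the same as the vertex of the SC-tree with 0-1 sequence $\overline{F}$.
   Context: SC-tree. Let $a,b$ be formal symbols. Consider the infinite binary tree $T$ (the ''S-tree with root $\frac ab$'') whose root is $\frac{a}{b}$ at level 0 and in which every vertex $\frac{u}{v}$ (including the root), where $u,v$ are formal integer linear forms in $a,b$, has left child $\frac{u}{u+v}$ and right child $\frac{v}{u+v}$ in the next level. The two children of a vertex of $T$ have the same denominator, of the form $ma+nb$. The SC-tree is obtained from $T$ by replacing, for each vertex $V$ of $T$, the two children of $V$, whose common denominator is $ma+nb$, by one single vertex $\frac{m}{n}$, placed in the same level as these children; the left (right) child of this SC-vertex is the SC-vertex obtained in the same way from the left (right) child of $V$. Thus level 1 consists of $\frac11$, level 2 of $\frac21,\frac12$ (from left to right), level 3 of $\frac31,\frac32,\frac13,\frac23$, and so on. (Two pseudo-fractions $\frac10,\frac01$ are also placed at level 0; they play no role here.) Stern-Brocot tree. Its vertices can be described as triples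 $(B_l,B,B_r)$ of fractions, the vertex itself being the middle term $B$. With the mediant $\frac{m_1}{n_1}\oplus\frac{m_2}{n_2}=\frac{m_1+m_2}{n_1+n_2}$, the root is $\left(\frac01,\frac11,\frac10\right)$, and the left and right children of $(B_l,B,B_r)$ are $(B_l,B_l\oplus B,B)$ and $(B,B\oplus B_r,B_r)$ respectively. 0-1 sequences. In each of the two trees, the left and the right child of $\frac11$ have 0-1 sequences $\overline{0}$ and $\overline{1}$ respectively, and the 0-1 sequence of the left (right) child of a vertex is obtained by appending the digit $0$ (respectively $1$) on the right of the 0-1 sequence of that vertex. The value of a 0-1 sequence is the integer it represents in binary. $\lfloor x\rfloor$ is the greatest integer $\le x$.
   Formalization: The condition r_{i+1}-(r_i+k_i) ≥ 0 is replaced by the strict r_{i+1}-(r_i+k_i) > 0, since the claim fails when equality occurs: t=2, r=(1,2), k=(1,2) gives E=11, F=10, whose vertices are 3/1 and 1/3. *)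

(* Defs.v *)
From mathcomp Require Import all_boot all_order all_algebra.

Set Implicit Arguments.
Unset Strict Implicit.
Unset Printing Implicit Defensive.

Import GRing.Theory.
Local Open Scope ring_scope.

(* A fraction m/n is the formal pair (m, n), so that 1/0 is allowed and
   equality is equality of numerators and of denominators. *)
Definition fraction : Type := (int * int)%type.

Definition mediant (x y : fraction) : fraction := (x.1 + y.1, x.2 + y.2).

(* A 0-1 sequence is a seq bool, leftmost digit first, with true for the
   digit 1 and false for the digit 0.  In both trees the empty sequence
   leads to 1/1. *)
Definition binary_value (s : seq bool) : nat :=
  foldl (fun (n : nat) (d : bool) => (2 * n + d)%N) 0%N s.

(* The linear form m a + n b is the pair (m, n). *)
Definition linform : Type := (int * int)%type.
Definition form_a : linform := (1, 0).
Definition form_b : linform := (0, 1).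
Definition form_add (u v : linform) : linform := (u.1 + v.1, u.2 + v.2).

(* The vertex u/v of the S-tree is the pair (u, v). *)
Definition S_vertex : Type := (linform * linform)%type.
Definition S_root : S_vertex := (form_a, form_b).
Definition S_left (V : S_vertex) : S_vertex := (V.1, form_add V.1 V.2).
Definition S_right (V : S_vertex) : S_vertex := (V.2, form_add V.1 V.2).
Definition S_child (V : S_vertex) (d : bool) : S_vertex :=
  if d then S_right V else S_left V.

Lemma S_child_denominator (V : S_vertex) : (S_left V).2 = (S_right V).2.
Proof. by []. Qed.

(* The vertex m/n that replaces the two children of V, where m a + n b is
   their common denominator. *)
Definition SC_of (V : S_vertex) : fraction :=
  let c := (S_left V).2 in (c.1, c.2).

Definition SC_vertex (s : seq bool) : fraction :=
  SC_of (foldl S_child S_root s).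

Record SB_triple : Type :=
  SBTriple { SB_l : fraction; SB_mid : fraction; SB_r : fraction }.

Definition SB_root : SB_triple := SBTriple (0, 1) (1, 1) (1, 0).
Definition SB_left (B : SB_triple) : SB_triple :=
  SBTriple (SB_l B) (mediant (SB_l B) (SB_mid B)) (SB_mid B).
Definition SB_right (B : SB_triple) : SB_triple :=
  SBTriple (SB_mid B) (mediant (SB_mid B) (SB_r B)) (SB_r B).
Definition SB_child (B : SB_triple) (d : bool) : SB_triple :=
  if d then SB_right B else SB_left B.

Definition SB_vertex (s : seq bool) : fraction :=
  SB_mid (foldl SB_child SB_root s).

(* Main.v *)
Require Import Defs.
From mathcomp Require Import all_boot all_order all_algebra.
From mathcomp Require Import zify.

(* The values of 1E and 1F say that 1F is the Gray code of 1E: the blocks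
   2^(r_i - 1) (2^(k_i) - 1) are the maximal runs of ones of n = 1E, so that
   the sum of the 2^(r_i - 1) (2^(k_i) + 1) is the exclusive or of n and 2n.
   Hence each digit of F tells whether the path E turns at that step.  Walking
   along E in the Stern-Brocot tree and along F in the S-tree, the pair u/v
   always consists of the two Stern-Brocot ancestors B_l and B_r, v being the
   more recent one; which of the two it is depends on the last digit of E. *)

Definition gray (p : bool) (s : seq bool) : seq bool := pairmap addb p s.

Lemma foldl_binary_value n s :
  foldl (fun (n : nat) (d : bool) => 2 * n + d) n s
  = n * 2 ^ size s + binary_value s.
Proof.
elim: s n => [|d s IHs] n; first by rewrite muln1 addn0.
by rewrite /binary_value /= IHs (IHs (2 * 0 + d)) expnS; nia.
Qed.

Lemma binary_value_cons d s :
  binary_value (d :: s) = d * 2 ^ size s + binary_value s.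
Proof. by rewrite {1}/binary_value /= foldl_binary_value. Qed.

Lemma binary_value_cat s u :
  binary_value (s ++ u) = binary_value s * 2 ^ size u + binary_value u.
Proof. by rewrite {1}/binary_value foldl_cat foldl_binary_value. Qed.

Lemma binary_value_rcons s d : binary_value (rcons s d) = 2 * binary_value s + d.
Proof. by rewrite /binary_value foldl_rcons. Qed.

Lemma binary_value_nseq0 n : binary_value (nseq n false) = 0.
Proof. by elim: n => // n IHn; rewrite /= binary_value_cons IHn. Qed.

Lemma binary_value_nseq1 n : binary_value (nseq n true) = 2 ^ n - 1.
Proof.
by elim: n => // n IHn; rewrite /= binary_value_cons size_nseq IHn expnS; lia.
Qed.

Lemma binary_value_inj s u :
  size s = size u -> binary_value s = binary_value u -> s = u.
Proof.
elim/last_ind: s u => [|s d IHs] u; first by move/esym/size0nil.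
case/lastP: u => [|u c]; rewrite !size_rcons // => -[eq_size].
rewrite !binary_value_rcons => eq_val.
have eq_dc : d = c by case: d c eq_val => -[]; lia.
by rewrite eq_dc (IHs u eq_size) //; move: eq_val; rewrite eq_dc; lia.
Qed.

Lemma gray_cat p s u : gray p (s ++ u) = gray p s ++ gray (last p s) u.
Proof. exact: pairmap_cat. Qed.

Lemma size_gray p s : size (gray p s) = size s.
Proof. exact: size_pairmap. Qed.

Lemma last_nseq (T : Type) n (x : T) : last x (nseq n x) = x.
Proof. by elim: n. Qed.

Lemma gray_nseq b n : gray b (nseq n b) = nseq n false.
Proof. by elim: n => //= n ->; rewrite addbb. Qed.

Lemma binary_value_gray_pad n s :
  binary_value (gray false (nseq n false ++ s)) = binary_value (gray false s).
Proof.
by rewrite gray_cat gray_nseq last_nseq binary_value_cat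
  binary_value_nseq0.
Qed.

(** The appended zero only adds a last Gray digit, which the floor drops. *)
Lemma binary_value_gray_rcons0 s :
  binary_value (gray false (rcons s false)) %/ 2 = binary_value (gray false s).
Proof.
rewrite -cats1 gray_cat /= cats1 binary_value_rcons.
by case: (_ (+) _); lia.
Qed.

(* The digits of [w] are those of twice the sum of the runs, so that the Gray
   code also has the digit closing the lowest run when [r 1 = 1]. *)
Lemma run_decomposition t (r k : nat -> nat) :
  (forall i, 1 <= i <= t -> 0 < r i) -> (forall i, 1 <= i <= t -> 0 < k i) ->
  (forall i, 1 <= i < t -> r i + k i < r i.+1) ->
  forall m, (0 < t -> r t + k t <= m) ->
  exists w, [/\ size w = m,
    binary_value w = \sum_(1 <= i < t.+1) 2 ^ (r i - 1) * (2 ^ (k i + 1) - 2) &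
    binary_value (gray false w) = \sum_(1 <= i < t.+1) 2 ^ (r i - 1) * (2 ^ k i + 1)].
Proof.
elim: t => [|t IHt] r_pos k_pos r_gap m le_m.
  exists (nseq m false); rewrite !big_geq // size_nseq gray_nseq.
  by rewrite binary_value_nseq0.
have {}le_m := le_m isT.
have rt_pos : 0 < r t.+1 by apply: r_pos; lia.
have kt_pos : 0 < k t.+1 by apply: k_pos; lia.
have [||||w [size_w val_w val_gray]] := IHt _ _ _ (r t.+1).-1.
- by move=> i lt_i; apply: r_pos; lia.
- by move=> i lt_i; apply: k_pos; lia.
- by move=> i lt_i; apply: r_gap; lia.
- by move=> t_pos; have := r_gap t; lia.
(* The new run starts at bit [r t.+1]; the zero just below it carries the Gray digit
   [2 ^ (r t.+1 - 1)] that closes the run. *)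
exists (nseq (m - (r t.+1 + k t.+1)) false ++ nseq (k t.+1) true ++ false :: w).
rewrite binary_value_gray_pad (big_nat_recr t.+1) //=
  (big_nat_recr t.+1) //= -val_w -val_gray.
move: rt_pos kt_pos le_m size_w; case: (r t.+1) => // a _; case: (k t.+1) => // b _.
move=> le_m /= size_w; split.
- by rewrite size_cat /= size_cat /= !size_nseq size_w; lia.
- rewrite binary_value_cat binary_value_nseq0 binary_value_cons binary_value_cat.
  rewrite binary_value_nseq1 binary_value_cons size_cat /= size_nseq size_w.
  rewrite subn1 addn1 /= expnD.
  rewrite !expnS; case: (2 ^ b) (expn_gt0 2 b) => // x _.
  have -> : 2 * (2 * x.+1) - 2 = 4 * x + 2 by lia.
  by rewrite subn1 /=; nia.
- rewrite /= gray_cat gray_nseq last_nseq /= binary_value_cons.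
  rewrite binary_value_cat binary_value_nseq0 binary_value_cons.
  rewrite size_cat /= size_nseq !size_gray size_w subn1 /=.
  by rewrite expnD !expnS; nia.
Qed.

(** Repeating the digit [e] keeps the older ancestor, [V.1], as [S_left] does; a turn keeps the
    newer one, [V.2], as [S_right] does. *)
Lemma S_tree_gray B V e s :
  V = (if e then (SB_r B, SB_l B) else (SB_l B, SB_r B)) ->
  SB_mid B = mediant (SB_l B) (SB_r B) ->
  SC_of (foldl S_child V (gray e s)) = SB_mid (foldl SB_child B s).
Proof.
have addC := GRing.addrC.
elim: s B V e => [|d s IHs] [l c r] V e /= -> /= ->.
  by case: e; rewrite /SC_of /mediant //= !(addC _ r.1) !(addC _ r.2).
by apply: IHs; case: e d => -[]; rewrite //= /S_left /S_right /form_add /mediant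
  //= 1?(addC _ r.1) 1?(addC _ r.2).
Qed.

(** Here [e] is [true] because [S_root] is the pair (1/0, 0/1), right ancestor first. *)
Lemma SC_vertex_gray E : SC_vertex (gray true E) = SB_vertex E.
Proof. exact: S_tree_gray. Qed.

(* The inequality r i + k i < r i.+1 must be strict: for t = 2, r = (1, 2) and
   k = (1, 2), where r 1 + k 1 = r 2, the two values are 7 and 6, that is
   E = 11 and F = 10, but these lead to 3/1 and 1/3.
   The numerator in the value of 1E is even, so that quotient is exact. *)
Theorem theorem17 (E F : seq bool) (t : nat) (r k : nat -> nat)
  (size_EF : size E = size F)
  (t_pos : 0 < t)
  (r_pos : forall i, 1 <= i <= t -> 0 < r i)
  (k_pos : forall i, 1 <= i <= t -> 0 < k i)
  (r_gap : forall i, 1 <= i < t -> r i + k i < r i.+1)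
  (value_1E : binary_value (true :: E) =
     (\sum_(1 <= i < t.+1) 2 ^ (r i - 1) * (2 ^ (k i + 1) - 2)) %/ 2)
  (value_1F : binary_value (true :: F) =
     (\sum_(1 <= i < t.+1) 2 ^ (r i - 1) * (2 ^ k i + 1)) %/ 2) :
  SB_vertex E = SC_vertex F.
Proof.
pose m := r t + k t + (size E).+2.
have [|w [size_w val_w val_gray]] := run_decomposition _ _ _ r_pos k_pos r_gap m.
  by rewrite /m; lia.
have even_w : 2 %| binary_value w.
  rewrite val_w; apply: dvdn_sum => i _; rewrite addn1 expnS.
  by rewrite dvdn_mull // dvdn_sub // dvdn_mulr.
have def_w : w = nseq (r t + k t) false ++ rcons (true :: E) false.
  apply: binary_value_inj; first by rewrite size_cat size_nseq size_rcons size_w.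
  rewrite binary_value_cat binary_value_nseq0 binary_value_rcons value_1E -val_w.
  by move: even_w; lia.
rewrite -SC_vertex_gray; congr SC_vertex.
(* With the leading 1 restored, the left side is [gray false (true :: E)]. *)
suff [] : true :: gray true E = true :: F by [].
apply: binary_value_inj; first by rewrite /= size_gray size_EF.
rewrite value_1F -val_gray def_w binary_value_gray_pad.
by rewrite binary_value_gray_rcons0.
Qed.
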